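(* Let $(X,\mathcal B)$ be a standard Borel space, and let $\mathcal{A}p\subset Aut(X,\mathcal B)$ be the set of aperiodic Borel automorphisms of $(X,\mathcal B)$. Then $\mathcal{A}p$ is closed and nowhere dense in $Aut(X,\mathcal B)$ with respect to the topology $\tau$, and $\mathcal{A}p$ is closed and nowhere dense in $Aut(X,\mathcal B)$ with respect to the topology $p$.
   Context: A standard Borel space $(X,\mathcal B)$ is a set $X$ with a $\sigma$-algebra $\mathcal B$ that is isomorphic to a Polish space equipped with its $\sigma$-algebra of Borel sets. $Aut(X,\mathcal B)$ is the group of all one-to-one Borel maps of $X$ onto itself (Borel automorphisms). $\mathcal M_1(X)$ is the set of all Borel probability measures on $(X,\mathcal B)$. An automorphism $T$ is called aperiodic if it has no periodic points, i.e. every orbit $\{T^nx : n\in\mathbb Z\}$, $x\in X$, is infinite. For $S,T\in Aut(X,\mathcal B)$ put $E(S,T)=\{x\in X : Tx\neq Sx\}\cup\{x\in X : T^{-1}x\neq S^{-1}x\}$. The uniform topology $\tau$ on $Aut(X,\mathcal B)$ is the topology defined by the base of neighborhoods consisting of the sets $$U(T;\mu_1,\dots,\mu_n;\varepsilon)=\{S\in Aut(X,\mathcal B) : \mu_i(E(S,T))<\varepsilon,\ i=1,\dots,n\},$$ where $T\in Aut(X,\mathcal B)$, $\mu_1,\dots,\mu_n\in\mathcal M_1(X)$ and $\varepsilon>0$. The weak topology $p$ on $Aut(X,\mathcal B)$ is the topology defined by the base of neighborhoods consisting of the sets $$W(T;F_1,\dots,F_k)=\{S\in Aut(X,\mathcal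 B) : SF_i=TF_i,\ i=1,\dots,k\},$$ where $T\in Aut(X,\mathcal B)$ and $F_1,\dots,F_k\in\mathcal B$. *)

(* Defs.v *)
From HB Require Import structures.
From mathcomp Require Import all_boot all_order all_algebra.
From mathcomp Require Import all_classical all_reals all_analysis.

Set Implicit Arguments.
Unset Strict Implicit.
Unset Printing Implicit Defensive.

Import Order.TTheory GRing.Theory Num.Theory.

Local Open Scope classical_set_scope.
Local Open Scope ring_scope.

#[short(type="completeMetricType")]
HB.structure Definition CompleteMetric (R : numDomainType) :=
  { M of Complete M & Metric R M }.

Definition separable_space (T : topologicalType) :=
  exists2 D : set T, countable D & dense D.

(* A Polish space is represented by a separable complete metric space; the
   choice of metric is immaterial, since only its Borel sets are used.  Both
   measurableType and completeMetricType are pointed, so the empty space is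
   excluded (it has no probability measure). *)
Definition standard_Borel (R : realType) d (X : measurableType d) : Prop :=
  exists P : completeMetricType R, separable_space P /\
  exists (f : X -> g_sigma_algebraType (@open P))
         (g : g_sigma_algebraType (@open P) -> X),
    [/\ cancel f g, cancel g f,
        measurable_fun [set: X] f &
        measurable_fun [set: g_sigma_algebraType (@open P)] g].

(* The field aut_inv is determined by aut_fun.  Its measurability is not a
   field: on a standard Borel space it is the Lusin-Souslin theorem. *)
Record borel_aut d (X : measurableType d) := BorelAut {
  aut_fun :> X -> X ;
  aut_inv : X -> X ;
  aut_funK : cancel aut_fun aut_inv ;
  aut_invK : cancel aut_inv aut_fun ;
  aut_measurable : measurable_fun [set: X] aut_fun
}.

Section Orbits.
Context d (X : measurableType d).
Implicit Types (T : borel_aut X) (x : X).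

Definition aut_pow T (n : int) : X -> X :=
  match n with
  | Posz k => iter k T
  | Negz k => iter k.+1 (aut_inv T)
  end.

Definition aut_orbit T x : set X := range (fun n : int => aut_pow T n x).

Definition aperiodic : set (borel_aut X) :=
  [set T | forall x, infinite_set (aut_orbit T x)].

End Orbits.

Section BasicNeighborhoods.
Context (R : realType) d (X : measurableType d).
Implicit Types S T : borel_aut X.

Definition diff_set S T : set X :=
  [set x | T x <> S x] `|` [set x | aut_inv T x <> aut_inv S x].

Definition tau_nbhd T n (mu : 'I_n -> probability X R) (eps : R) :
    set (borel_aut X) :=
  [set S | forall i, (mu i (diff_set S T) < eps%:E)%E].

Definition p_nbhd T k (F : 'I_k -> set X) : set (borel_aut X) :=
  [set S | forall i, S @` F i = T @` F i].

Definition tau_open (V : set (borel_aut X)) : Prop :=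
  forall T, V T -> exists n (mu : 'I_n -> probability X R) (eps : R),
    0 < eps /\ tau_nbhd T mu eps `<=` V.

Definition p_open (V : set (borel_aut X)) : Prop :=
  forall T, V T -> exists k (F : 'I_k -> set X),
    (forall i, measurable (F i)) /\ p_nbhd T F `<=` V.

Lemma tau_openT : tau_open setT.
Proof.
by move=> T _; exists 0%N, (fun i : 'I_0 => match notF (ltn_ord i) with end), 1.
Qed.

Lemma tau_openI : setI_closed tau_open.
Proof.
move=> A B oA oB T [/oA[m [mu [e [e0 muA]]]] /oB[n [nu [e' [e'0 nuB]]]]].
exists (m + n)%N,
  (fun i : 'I_(m + n) => match fintype.split i with inl j => mu j | inr j => nu j end),
  (Num.min e e').
split=> [|S TS]; first by rewrite lt_min e0.
split.
- apply: muA => i; have := TS (lshift n i).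
  rewrite (unsplitK (inl i : 'I_m + 'I_n)) => /lt_le_trans; apply.
  by rewrite lee_fin ge_min lexx.
- apply: nuB => i; have := TS (rshift m i).
  rewrite (unsplitK (inr i : 'I_m + 'I_n)) => /lt_le_trans; apply.
  by rewrite lee_fin ge_min lexx orbT.
Qed.

Lemma tau_open_bigU (I : Type) (f : I -> set (borel_aut X)) :
  (forall i, tau_open (f i)) -> tau_open (\bigcup_i f i).
Proof.
move=> of_ T [i _ /of_[n [mu [e [e0 fi]]]]]; exists n, mu, e; split=> //.
by move=> S /fi fiS; exists i.
Qed.

Lemma p_openT : p_open setT.
Proof. by move=> T _; exists 0%N, (fun=> set0); split=> // -[]. Qed.

Lemma p_openI : setI_closed p_open.
Proof.
move=> A B oA oB T [/oA[m [F [mF FA]]] /oB[n [G [mG GB]]]].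
exists (m + n)%N,
  (fun i : 'I_(m + n) => match fintype.split i with inl j => F j | inr j => G j end).
split=> [i|S TS]; first by case: fintype.split.
split.
- apply: FA => i; have := TS (lshift n i).
  by rewrite (unsplitK (inl i : 'I_m + 'I_n)).
- apply: GB => i; have := TS (rshift m i).
  by rewrite (unsplitK (inr i : 'I_m + 'I_n)).
Qed.

Lemma p_open_bigU (I : Type) (f : I -> set (borel_aut X)) :
  (forall i, p_open (f i)) -> p_open (\bigcup_i f i).
Proof.
move=> of_ T [i _ /of_[k [F [mF fi]]]]; exists k, F; split=> //.
by move=> S /fi fiS; exists i.
Qed.

End BasicNeighborhoods.

Definition aut_tau (R : realType) d (X : measurableType d) := borel_aut X.
Definition aut_p d (X : measurableType d) := borel_aut X.

HB.instance Definition _ (R : realType) d (X : measurableType d) :=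
  gen_eqMixin (aut_tau R X).
HB.instance Definition _ (R : realType) d (X : measurableType d) :=
  gen_choiceMixin (aut_tau R X).
HB.instance Definition _ (R : realType) d (X : measurableType d) :=
  isOpenTopological.Build (aut_tau R X)
    (@tau_openT R d X) (@tau_openI R d X) (@tau_open_bigU R d X).

HB.instance Definition _ d (X : measurableType d) := gen_eqMixin (aut_p X).
HB.instance Definition _ d (X : measurableType d) := gen_choiceMixin (aut_p X).
HB.instance Definition _ d (X : measurableType d) :=
  isOpenTopological.Build (aut_p X)
    (@p_openT d X) (@p_openI d X) (@p_open_bigU d X).

Definition nowhere_dense (T : topologicalType) (A : set T) : Prop :=
  interior (closure A) = set0.

(* Main.v *)
(* If T is periodic at x, every S that agrees with T on the finite orbit of x is
   periodic at x as well; this agreement is enforced by finitely many Dirac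
   masses (for tau) or finitely many singletons (for p), so the complement of
   the aperiodic automorphisms is open.  Conversely, for aperiodic T and points
   a and b = T^k a of one orbit, T composed with the transposition of a and b
   has the finite orbit Ta, ..., T^k a = b.  For tau take b = Ta with a far along
   an orbit, where finitely many given probabilities have small tails; for p
   take a and b in the same atom of the algebra generated by F_1, ..., F_n. *)
Require Import Defs.
From mathcomp Require Import all_boot all_order all_algebra.
From mathcomp Require Import all_classical all_reals all_analysis.

Set Implicit Arguments.
Unset Strict Implicit.
Unset Printing Implicit Defensive.

Import Order.TTheory.

Local Open Scope classical_set_scope.

Lemma injective_nat {U : Type} (f : nat -> U) :
  (forall m k, f m <> f (m + k.+1)%N) -> injective f.
Proof.
move=> fne m n; wlog le_mn : m n / (m <= n)%N => [hw|].
  by move=> fmn; case: (leqP m n) => [|/ltnW] le_mn; [|symmetry]; apply: hw.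
rewrite -(subnKC le_mn); case: (n - m)%N => [|k fmk]; first by rewrite addn0.
by have := fne m k.
Qed.

Lemma infinite_set_injective_nat {U : Type} (f : nat -> U) (A : set U) :
  injective f -> (forall n, A (f n)) -> infinite_set A.
Proof.
move=> injf fA finA; apply: infinite_nat; have <- : f @^-1` A = setT.
  by apply/seteqP; split=> // n _; apply: fA.
by apply: finite_preimage => // m n _ _; apply: injf.
Qed.

(** Pigeonhole: a sequence without such a repetition would be injective and make [U] infinite. *)
Lemma finType_collision (U : finType) (f : nat -> U) :
  exists m k, f m = f (m + k.+1)%N.
Proof.
apply: contrapT => nf.
apply: (@infinite_set_injective_nat U f setT) => //.
by apply: injective_nat => m k fmk; apply: nf; exists m, k.
Qed.

(** By induction both orbits stay at the same point, so agreement along the [f]-orbit alone suffices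
    to carry a period of [f] over to [g]. *)
Lemma eq_iter_on_orbit {U : Type} (f g : U -> U) x n :
  (forall i, (i < n)%N -> g (iter i f x) = f (iter i f x)) ->
  iter n g x = iter n f x.
Proof.
elim: n => // n IHn fg /=; rewrite IHn ?fg// => i lt_in.
by apply: fg; apply: leq_trans lt_in _.
Qed.

Section transposition.
Context {U : eqType}.
Implicit Types a b x : U.

Definition transp a b x := if x == a then b else if x == b then a else x.

Lemma transpl a b : transp a b a = b.
Proof. by rewrite /transp eqxx. Qed.

Lemma transpr a b : transp a b b = a.
Proof. by rewrite /transp eqxx; case: eqP. Qed.

Lemma transp_out a b x : x <> a -> x <> b -> transp a b x = x.
Proof. by rewrite /transp => /eqP/negbTE-> /eqP/negbTE->. Qed.

Lemma transpK a b : involutive (transp a b).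
Proof.
move=> x; have [->|/eqP xa] := eqVneq x a; first by rewrite transpl transpr.
have [->|/eqP xb] := eqVneq x b; first by rewrite transpr transpl.
by rewrite !transp_out.
Qed.

Lemma image_transp a b (A : set U) : (A a <-> A b) -> transp a b @` A = A.
Proof.
move=> Aab; have sA x : A x -> A (transp a b x).
  have [->|/eqP xa] := eqVneq x a; first by rewrite transpl => /Aab.
  have [->|/eqP xb] := eqVneq x b; first by rewrite transpr => /Aab.
  by rewrite transp_out.
apply/seteqP; split=> [_ [x Ax <-]|x Ax]; first exact: sA.
by exists (transp a b x); [exact: sA|exact: transpK].
Qed.

End transposition.

(** Points are closed in a metric space, and the injective measurable [f] pulls [[set f x]] back to
    [[set x]]. *)
Lemma standard_Borel_measurable_set1 (R : realType) d (X : measurableType d) :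
  standard_Borel R X -> forall x : X, measurable [set x].
Proof.
move=> [P [_ [f [g [fK _ mf _]]]]] x.
have -> : [set x] = setT `&` f @^-1` [set f x].
  by rewrite setTI; apply/seteqP; split=> [y ->//|y /(can_inj fK)].
apply: mf => //; rewrite -[[set f x]]setCK; apply: measurableC.
apply: sub_sigma_algebra; rewrite openC.
exact: accessible_closed_set1 (hausdorff_accessible (@metric_hausdorff R P)) _.
Qed.

Lemma countable_image_nat {U : Type} (y : nat -> U) (A : set nat) :
  countable (y @` A).
Proof. exact: sub_countable (card_image_le _ _) (countableP _). Qed.

(** Injectivity of [y] makes the tails decrease to the empty set; a finite measure is continuous
    from above. *)
Lemma cvg_mu_tail (R : realType) d (X : measurableType d)
    (mu : probability X R) (y : nat -> X) :
  (forall x : X, measurable [set x]) -> injective y ->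
  mu (y @` [set k | (n <= k)%N]) @[n --> \oo] --> 0%E.
Proof.
move=> m1 injy; pose A n := y @` [set k | (n <= k)%N].
have mA n : measurable (A n).
  by apply: countable_measurable => //; apply: countable_image_nat.
have A0 : \bigcap_n A n = set0.
  apply/seteqP; split=> // x Ax; have [k _ yk] := Ax 0%N I.
  have [l /= lt_kl yl] := Ax k.+1 I.
  by move: lt_kl; rewrite (injy l k) ?ltnn// yl.
rewrite -(measure0 mu) -A0; apply: (@nonincreasing_cvg_mu _ _ _ mu A) => //.
- exact: le_lt_trans (probability_le1 mu (mA 0%N)) (ltry _).
- by rewrite A0.
- move=> m n le_mn; apply/subsetPset => x [k /= le_nk <-].
  by exists k => //=; apply: leq_trans le_nk.
Qed.

(** * Orbits and periodic points *)

Section aut.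
Context d (X : measurableType d).
Implicit Types (S T : borel_aut X) (x a b : X).

Lemma aut_inj T : injective T.
Proof. exact: can_inj (aut_funK T). Qed.

Lemma iter_aut_inj T n : injective (iter n T).
Proof. by elim: n => // n IHn x y /= /aut_inj/IHn. Qed.

(** The first [p.+1] iterates form a set stable under both [T] and its inverse, so it contains the
    two-sided orbit. *)
Lemma finite_aut_orbit T x p : iter p.+1 T x = x -> finite_set (aut_orbit T x).
Proof.
move=> px; apply: (@sub_finite_set _ _ ((fun i => iter i T x) @` `I_p.+1)); last first.
  exact: finite_image (finite_II _).
have stepT y : ((fun i => iter i T x) @` `I_p.+1) y ->
    ((fun i => iter i T x) @` `I_p.+1) (T y).
  move=> [i /= lt_ip <-]; move: lt_ip; rewrite ltnS leq_eqVlt => /orP[/eqP->|lt_ip].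
    by exists 0%N => //=; rewrite -[RHS]px.
  by exists i.+1.
have stepV y : ((fun i => iter i T x) @` `I_p.+1) y ->
    ((fun i => iter i T x) @` `I_p.+1) (aut_inv T y).
  move=> [[|i] /= lt_ip <-].
    (* The inverse sends [x] itself back to the last iterate [iter p T x]. *)
    by exists p => //=; rewrite -[in RHS]px /= aut_funK.
  by exists i; rewrite /= ?aut_funK//; apply: ltnW.
move=> _ [n _ <-]; case: n => n; rewrite /aut_pow.
  by elim: n => [|n IHn]; [exists 0%N|exact: stepT].
by elim: n.+1 => [|k IHk]; [exists 0%N|exact: stepV].
Qed.

Lemma iter_inj_aut T x : (forall p, iter p.+1 T x <> x) ->
  injective (fun n => iter n T x).
Proof.
move=> npx; apply: injective_nat => m k; rewrite iterD => /iter_aut_inj /esym.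
exact: npx.
Qed.

Lemma aperiodicP T : aperiodic T <-> forall x p, iter p.+1 T x <> x.
Proof.
split=> [aT x p /finite_aut_orbit|npT x]; first exact: aT.
apply: (@infinite_set_injective_nat _ _ (aut_orbit T x) (iter_inj_aut (npT x))).
by move=> n; exists (Posz n).
Qed.

Lemma not_aperiodicP T : ~ aperiodic T <-> exists x p, iter p.+1 T x = x.
Proof.
rewrite aperiodicP; split=> [nT|[x [p px]] /(_ x p)]; last exact.
by apply: contrapT => nex; apply: nT => x p px; apply: nex; exists x, p.
Qed.

Lemma aperiodic_iter_inj T x : aperiodic T -> injective (fun n => iter n T x).
Proof. by move=> /aperiodicP aT; exact: iter_inj_aut. Qed.

(** * Composition with a transposition *)

Section aut_transp.
Hypothesis m1 : forall x : X, measurable [set x].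

Lemma measurable_transp a b : measurable_fun [set: X] (transp a b).
Proof.
have m_eq c : measurable_fun [set: X] (eq_op^~ c).
  apply: (measurable_fun_bool true); rewrite setTI.
  by have -> : (eq_op^~ c) @^-1` [set true] = [set c] by
    apply/seteqP; split=> x /= /eqP.
by do 2 (apply: measurable_fun_ifT; rewrite ?m_eq//).
Qed.

(** The transposition acts before [T]: images of sets that it preserves stay the same, and the map
    changes at most at [a] and [b]. *)
Definition aut_transp T a b : borel_aut X :=
  @BorelAut d X (T \o transp a b) (transp a b \o aut_inv T)
    (can_comp (aut_funK T) (transpK a b))
    (can_comp (transpK a b) (aut_invK T))
    (measurableT_comp (aut_measurable T) (measurable_transp a b)).

Lemma aut_transp_image T a b (A : set X) :
  (A a <-> A b) -> aut_transp T a b @` A = T @` A.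
Proof.
move=> Aab; rewrite -[in RHS](image_transp Aab).
by rewrite [RHS]image_comp.
Qed.

(** The forward maps can differ only at [a] and [b], the inverse maps only at [T a] and [T b]. *)
Lemma diff_set_aut_transp T a b :
  diff_set (aut_transp T a b) T `<=` [set a; b; T a; T b].
Proof.
move=> x [nTx|nTx].
  have [xa|/eqP xa] := eqVneq x a; first by do 3 left.
  have [xb|/eqP xb] := eqVneq x b; first by do 2 left; right.
  by case: nTx; rewrite /= transp_out.
have [xa|/eqP xa] := eqVneq (aut_inv T x) a.
  by left; right; rewrite -xa /= aut_invK.
have [xb|/eqP xb] := eqVneq (aut_inv T x) b.
  by right; rewrite -xb /= aut_invK.
by case: nTx; rewrite /= transp_out.
Qed.

Lemma aut_transp_periodic T a k : aperiodic T ->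
  ~ aperiodic (aut_transp T a (iter k.+1 T a)).
Proof.
move=> /(@aperiodic_iter_inj T a) injT; set b := iter k.+1 T a.
apply/not_aperiodicP; exists b, k.
(* The first step sends [b] to [T a]. After that the orbit follows [T], avoiding [a] and [b] by
   injectivity, until it returns to [b] at [i = k]. *)
suff H i : (i <= k)%N -> iter i.+1 (aut_transp T a b) b = iter i.+1 T a by exact: H.
elim: i => [_|i IHi lt_ik]; first by rewrite /= transpr.
rewrite iterS IHi 1?ltnW//= transp_out// => [/(injT i.+1 0%N)//|].
by move=> /(injT i.+1 k.+1) [ik]; rewrite ik ltnn in lt_ik.
Qed.

End aut_transp.

End aut.

Lemma nowhere_dense_closed (U : topologicalType) (A : set U) : closed A ->
  (forall V, open V -> V `<=` A -> V = set0) -> nowhere_dense A.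
Proof.
move=> /closure_id cA nA; rewrite /nowhere_dense -cA.
by apply: nA; [exact: open_interior|exact: interior_subset].
Qed.

(** * The uniform topology *)

Section tau.
Context (R : realType) d (X : measurableType d).

Lemma closed_aperiodic_tau : closed (@aperiodic d X : set (aut_tau R X)).
Proof.
rewrite -openC; change (tau_open R (~` @aperiodic d X)) => T /not_aperiodicP[x [p px]].
(* A Dirac mass takes only the values 0 and 1, so a bound below 1 keeps its point out of
   [diff_set S T]. *)
exists p.+1, (fun i => dirac (iter i T x) : probability X R), 1%R; split=> // S TS.
apply/not_aperiodicP; exists x, p; rewrite (eq_iter_on_orbit (f := T))// => i lt_ip.
apply: contrapT => STi; have := TS (Ordinal lt_ip).
rewrite /= diracE mem_set; first by rewrite ltxx.
by left=> TSi; apply: STi.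
Qed.

Lemma open_sub_aperiodic_tau (V : set (aut_tau R X)) :
  (forall x : X, measurable [set x]) -> open V -> V `<=` @aperiodic d X -> V = set0.
Proof.
move=> m1 oV Vap; apply/seteqP; split=> // T VT.
have [n [mu [e [e0 muV]]]] := oV T VT.
have aT := Vap T VT; pose y k := iter k T (point : X).
have injy : injective y := aperiodic_iter_inj aT.
(* Finitely many tails tend to 0, so a single [N] serves all the [mu i]. *)
have [N _ /(_ N (leqnn N)) small] :
    \forall N \near \oo, forall i, (mu i (y @` [set k | (N <= k)%N]) < e%:E)%E.
  apply: filter_forall => i; have nbhs0 : nbhs (0%E : \bar R) (fun u => (u < e%:E)%E).
    by apply: open_ereal_lt'; rewrite lte_fin.
  exact: (cvg_mu_tail (mu i) m1 injy nbhs0).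
pose S := aut_transp m1 T (y N) (y N.+1).
(* With index 0 the swapped points are [y N] and its image [y N.+1], and the latter becomes a fixed
   point of [S]. *)
case: (@aut_transp_periodic _ _ m1 T (y N) 0 aT).
apply: (Vap S); apply: muV => i; apply: le_lt_trans (small i).
have sub4 : [set y N; y N.+1; T (y N); T (y N.+1)] `<=` y @` [set k | (N <= k)%N].
  by move=> x [[[|]|]|] ->; [exists N|exists N.+1|exists N.+1|exists N.+2];
    rewrite //= ?leqW.
have subD : diff_set S T `<=` [set y N; y N.+1; T (y N); T (y N.+1)].
  exact: diff_set_aut_transp.
apply: le_measure; rewrite ?inE.
(* The difference set is measurable because it is countable, being contained in the tail. *)
- by apply: countable_measurable => //; apply: sub_countable (countable_image_nat y _);
    apply: subset_card_le; apply: subset_trans sub4.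
- by apply: countable_measurable => //; exact: countable_image_nat.
- exact: subset_trans sub4.
Qed.

End tau.

(** * The weak topology *)

Section weak.
Context d (X : measurableType d).
Hypothesis m1 : forall x : X, measurable [set x].

Lemma closed_aperiodic_p : closed (@aperiodic d X : set (aut_p X)).
Proof.
rewrite -openC; change (p_open (~` @aperiodic d X)) => T /not_aperiodicP[x [p px]].
exists p.+1, (fun i => [set iter i T x]); split=> [//|S TS].
apply/not_aperiodicP; exists x, p; rewrite (eq_iter_on_orbit (f := T))// => i lt_ip.
by have := TS (Ordinal lt_ip); rewrite !image_set1 => /(congr1 (@^~ _))/= <-.
Qed.

Lemma open_sub_aperiodic_p (V : set (aut_p X)) :
  open V -> V `<=` @aperiodic d X -> V = set0.
Proof.
move=> oV Vap; apply/seteqP; split=> // T VT.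
have [k [F [_ FV]]] := oV T VT; have aT := Vap T VT.
(* The boolean vector records which [F i] contain the [n]-th orbit point, that is, its atom. There
   are finitely many vectors, so two orbit points share an atom. *)
have [m [l /ffunP Fml]] := finType_collision
  (fun n => [ffun i : 'I_k => `[< F i (iter n T point) >]]).
case: (@aut_transp_periodic _ _ m1 T (iter m T point) l aT).
apply: Vap; apply: FV => i; apply: aut_transp_image.
have := Fml i; rewrite !ffunE -iterD addnC => Fi.
by split=> /asboolP; [rewrite Fi|rewrite -Fi] => /asboolP.
Qed.

End weak.

Theorem theorem3p7 (R : realType) (d : measure_display)
    (X : measurableType d) (hX : standard_Borel R X) :
  (closed (@aperiodic d X : set (aut_tau R X)) /\
   nowhere_dense (@aperiodic d X : set (aut_tau R X))) /\
  (closed (@aperiodic d X : set (aut_p X)) /\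
   nowhere_dense (@aperiodic d X : set (aut_p X))).
Proof.
have m1 := standard_Borel_measurable_set1 hX.
have clt := @closed_aperiodic_tau R d X.
have clp := @closed_aperiodic_p d X m1.
split; split=> //; apply: nowhere_dense_closed => // V.
- exact: open_sub_aperiodic_tau.
- exact: open_sub_aperiodic_p.
Qed.
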